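(* Let $m\geqslant 2$ be an integer, let $\alpha>0$ be real, let $\beta_0=\beta_0(m)$ be the unique solution of $\beta^{m+1}-\beta^2-\beta-1=0$ on $(1,\infty)$, and let $\mathcal{A}:=\{(1,m),(2,2m),(3,3m)\}$. Then, for every $\beta\geqslant\beta_0$, there exist $X,Y\sim\mathrm{Unif}\{\alpha,\alpha\beta,\alpha\beta^2\}$ for which $\mathcal{U}(X,Y)=\mathcal{A}$. Nevertheless, if $k>4m$ is an integer, there exists $\beta\in(1,\beta_0)$ such that $\{(4,k)\}\cup\mathcal{A}\subseteq\mathcal{U}(X,Y)\neq\mathbb{N}^2$ for some $X,Y\sim\mathrm{Unif}\{\alpha,\alpha\beta,\alpha\beta^2\}$.
   Context: $\mathbb{N}=\{1,2,3,\dots\}$. For a random vector $(X,Y)$ whose components have finite moments of all orders, the uncorrelatedness set is $\mathcal{U}(X,Y)=\{(j,k)\in\mathbb{N}^2: \mathbf{E}[X^jY^k]=\mathbf{E}[X^j]\,\mathbf{E}[Y^k]\}$. $X\sim\mathrm{Unif}\{a,b,c\}$ means that $X$ takes each of the three values $a,b,c$ with probability $1/3$; ''$X,Y\sim \mathrm{Unif}\{a,b,c\}$'' means that $(X,Y)$ is a random vector (with an arbitrary joint distribution) both of whose marginals are $\mathrm{Unif}\{a,b,c\}$. *)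

(* Defs.v *)
From HB Require Import structures.
From mathcomp Require Import all_boot all_order all_algebra.
From mathcomp Require Import all_classical all_reals all_analysis.

Set Implicit Arguments.
Unset Strict Implicit.
Unset Printing Implicit Defensive.

Import Order.TTheory GRing.Theory Num.Theory.
Import numFieldNormedType.Exports.

Local Open Scope classical_set_scope.
Local Open Scope ring_scope.

(* N^2 for N = {1, 2, 3, ...} *)
Definition posnat2 : set (nat * nat) :=
  [set jk | (0 < jk.1)%N /\ (0 < jk.2)%N].

(* Meaningful when X and Y have finite moments of all orders (so that every
   expectation below is finite), e.g. when they take finitely many values. *)
Definition uncorrelatedness_set (d : measure_display) (T : measurableType d)
    (R : realType) (P : probability T R) (X Y : {RV P >-> R}) :
    set (nat * nat) :=
  [set jk | posnat2 jk /\
    ('E_P[fun t => (X t ^+ jk.1 * Y t ^+ jk.2)%R] =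
     'E_P[fun t => (X t ^+ jk.1)%R] * 'E_P[fun t => (Y t ^+ jk.2)%R])%E].

(* X ~ Unif{a, b, c}, for pairwise distinct a, b, c. *)
Definition unif3 (d : measure_display) (T : measurableType d) (R : realType)
    (P : probability T R) (X : {RV P >-> R}) (a b c : R) : Prop :=
  [/\ P (X @^-1` [set a]) = (3%:R^-1)%:E,
      P (X @^-1` [set b]) = (3%:R^-1)%:E &
      P (X @^-1` [set c]) = (3%:R^-1)%:E].

(* Main.v *)
Require Import Defs.
From HB Require Import structures.
From mathcomp Require Import all_boot all_order all_algebra.
From mathcomp Require Import all_classical all_reals all_analysis.
From mathcomp Require Import measurable_realfun ring lra zify.

Set Implicit Arguments.
Unset Strict Implicit.
Unset Printing Implicit Defensive.

Import Order.TTheory GRing.Theory Num.Theory.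
Import numFieldNormedType.Exports.

Local Open Scope classical_set_scope.
Local Open Scope ring_scope.

(** A joint law with both marginals uniform on three points is the product law
    plus a 3 x 3 perturbation [h] whose rows and columns sum to zero.  With
    [x = beta ^+ j] and [y = beta ^+ k], the defect
    [E[X^j Y^k] - E[X^j] E[Y^k]] is [alpha ^+ (j + k)] times the polynomial
    [\sum h r s * x ^+ r * y ^+ s].  The zero row and column sums say exactly
    that this polynomial is divisible by [(x - 1) * (y - 1)]; the cofactor is
    an arbitrary bilinear form [a + b x + c y + d x y], because a small multiple
    of any perturbation keeps all nine probabilities nonnegative.  So the
    uncorrelatedness sets that arise are the traces on the points
    [(beta ^+ j, beta ^+ k)] of the zero sets of bilinear forms
    ([bilinear_uncorrelatedness]).

    Put [q = beta] and [Q = beta ^+ m].  Passing through the three points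
    [(q ^+ i, Q ^+ i)], [i = 1, 2, 3], determines the bilinear form up to a
    factor.  Its zero set is the graph of a Moebius map, increasing on each side
    of its pole, which lies beyond [q ^+ 3]
    ([moebius_form_before_pole]).  The pole is at most [q ^+ 4] if and only if
    [q ^+ 2 + q + 1 <= q ^+ m.+1], that is, [beta0 <= beta].  In that case the
    map has no positive value at any [q ^+ j] with [4 <= j], so the zero set
    contains no lattice point besides the three prescribed ones
    ([moebius_form_beyond_pole]).

    If [beta < beta0], then the value of the map at [q ^+ 4] is positive.  It
    tends to infinity as [beta] increases to [beta0], and behaves like
    [q ^+ (4 * m)] as [beta] decreases to 1, so it equals [q ^+ k] somewhere in
    between for each [k > 4 * m] ([fourth_point_root]).  Since the map is
    single-valued, some pair remains correlated. *)

(** * Laws with finitely many atoms *)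

(** The sample space is [nat * nat] because every function of one coordinate is
    measurable there, so powers of the two values can be used directly. *)
Lemma finite_law_exists (R : realType) (n : nat) (w : nat -> nat -> R) :
  (forall r s, 0 <= w r s) ->
  \sum_(r < n) \sum_(s < n) w r s = 1 ->
  exists P : probability (nat * nat)%type R,
    forall f : nat * nat -> R, measurable_fun setT f -> (forall t, 0 <= f t) ->
      ('E_P[f] =
       (\sum_(r < n) \sum_(s < n) w r s * f (r : nat, s : nat))%R%:E)%E.
Proof.
move=> w0 w1.
pose u r s : {nonneg R} := NngNum (w0 r s).
pose mu : {measure set (nat * nat) -> \bar R} := msum (fun r => msum (fun s =>
  mscale (u r s) (dirac (r, s) : {measure set (nat * nat) -> \bar R})) n) n.
have muI (f : nat * nat -> R) : measurable_fun setT f -> (forall t, 0 <= f t) ->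
    (\int[mu]_t (f t)%:E)%E =
    (\sum_(r < n) \sum_(s < n) w r s * f (r : nat, s : nat))%:E.
  move=> mf f0.
  move: (mf) => /measurable_EFinP mfE.
  rewrite ge0_integral_measure_sum//; last by move=> t _; rewrite lee_fin.
  rewrite -sumEFin; apply: eq_bigr => r _.
  rewrite ge0_integral_measure_sum//; last by move=> t _; rewrite lee_fin.
  rewrite -sumEFin; apply: eq_bigr => s _.
  rewrite ge0_integral_mscale//; last by move=> t _; rewrite lee_fin.
  by rewrite integral_dirac// diracT mul1e EFinM.
have muT : mu setT = 1%E.
  have <- : (\int[mu]_t (cst 1 t)%:E)%E = mu setT.
    exact: (etrans (integral_cst _ measurableT 1%E) (mul1e _)).
  rewrite (muI _ (measurable_cst _) (fun=> ler01)).
  congr EFin; rewrite -[RHS]w1.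
  by apply: eq_bigr => r _; apply: eq_bigr => s _; exact: mulr1.
(* [mu] already has mass one, so normalizing it only repackages it as a
   probability; the Dirac mass is the fallback for infinite or zero mass. *)
pose P : probability (nat * nat)%type R := mnormalize mu (dirac (0%N, 0%N)).
have Pmu : (P : set (nat * nat) -> \bar R) = mu.
  by apply/funext => A; rewrite /P /= /mnormalize muT onee_eq0/= invr1 mule1.
by exists P => f mf f0; rewrite unlock Pmu; exact: muI.
Qed.

(** * Uncorrelatedness sets as zero sets of bilinear forms *)

(** The perturbation has generating polynomial
    [(x - 1) * (y - 1) * (a + b * x + c * y + d * (x * y))]: the factor
    [(x - 1) * (y - 1)] preserves the marginals, and it does not vanish at
    [x = beta ^+ j], [y = beta ^+ k] for positive [j] and [k]. *)
Lemma bilinear_uncorrelatedness (R : realType) (alpha beta a b c d : R) :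
  0 < alpha -> 1 < beta ->
  exists (disp : measure_display) (T : measurableType disp)
         (P : probability T R) (X Y : {RV P >-> R}),
    [/\ unif3 X alpha (alpha * beta) (alpha * beta ^+ 2),
        unif3 Y alpha (alpha * beta) (alpha * beta ^+ 2) &
        uncorrelatedness_set X Y =
        [set jk | posnat2 jk /\
          a + b * beta ^+ jk.1 + c * beta ^+ jk.2
            + d * (beta ^+ jk.1 * beta ^+ jk.2) = 0]].
Proof.
move=> alpha0 beta1.
have beta0 : 0 < beta by lra.
(* [D0] and [D1] are the coefficient sequences of [x - 1] and [x * (x - 1)]. *)
pose D0 (r : nat) : R := (r == 1%N)%:R - (r == 0%N)%:R.
pose D1 (r : nat) : R := (r == 2%N)%:R - (r == 1%N)%:R.
pose h r s := a * (D0 r * D0 s) + b * (D1 r * D0 s)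
            + c * (D0 r * D1 s) + d * (D1 r * D1 s).
(* All entries of [h] are at most [M - 1] in absolute value, and [e] is chosen
   so that [9^-1 = e * M]; hence [9^-1 + e * h r s] is nonnegative. *)
pose M : R := `|a| + `|b| + `|c| + `|d| + 1.
have M0 : 0 < M by rewrite ltr_wpDl// !addr_ge0.
pose e : R := (9 * M)^-1.
have e0 : 0 < e by rewrite invr_gt0 mulr_gt0.
have eM : 9^-1 = e * M by rewrite /e; field; rewrite gt_eqF.
pose w r s := 9^-1 + e * h r s.
have w0 r s : 0 <= w r s.
  rewrite /w eM -mulrDr mulr_ge0 ?(ltW e0)//.
  have nle (x : R) : - `|x| <= x <= `|x| by rewrite -ler_norml.
  have /andP[a1 a2] := nle a; have /andP[b1 b2] := nle b.
  have /andP[c1 c2] := nle c; have /andP[d1 d2] := nle d.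
  by rewrite /M /h /D0 /D1; case: r => [|[|[|r]]]; case: s => [|[|[|s]]] /=; lra.
have w1 : \sum_(r < 3) \sum_(s < 3) w r s = 1.
  by rewrite /w /h /D0 /D1 !big_ord_recr !big_ord0 /=; field.
have [P EP] := finite_law_exists w0 w1.
have mpow : measurable_fun setT (fun n : nat => alpha * beta ^+ n) by [].
pose Xf (t : nat * nat) : R := alpha * beta ^+ t.1.
pose Yf (t : nat * nat) : R := alpha * beta ^+ t.2.
have mX : measurable_fun setT Xf.
  by apply: (measurableT_comp mpow); exact: measurable_fst.
have mY : measurable_fun setT Yf.
  by apply: (measurableT_comp mpow); exact: measurable_snd.
have X0 t : 0 <= Xf t by rewrite /Xf mulr_ge0 ?exprn_ge0 ?ltW.
have Y0 t : 0 <= Yf t by rewrite /Yf mulr_ge0 ?exprn_ge0 ?ltW.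
pose X : {RV P >-> R} := mfun_Sub (mem_set mX).
pose Y : {RV P >-> R} := mfun_Sub (mem_set mY).
have exp_inj : injective (GRing.exp beta).
  by apply: ieexprIn => //; rewrite gt_eqF.
have atom (Z : {RV P >-> R}) (g : nat * nat -> nat) (i : nat) :
    (forall t, Z t = alpha * beta ^+ g t) ->
    P (Z @^-1` [set alpha * beta ^+ i]) =
    (\sum_(r < 3) \sum_(s < 3) w r s * (g (r : nat, s : nat) == i)%:R)%:E.
  move=> Zg.
  have mA : measurable (Z @^-1` [set alpha * beta ^+ i]).
    by rewrite -[X in measurable X]setTI; exact: measurable_funP.
  rewrite -expectation_indic// EP//.
  congr EFin; apply: eq_bigr => r _; apply: eq_bigr => s _; congr (_ * _).
  rewrite indicE; congr (nat_of_bool _)%:R.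
  apply/idP/eqP => [|gi]; last by apply/mem_set; rewrite /= Zg gi.
  by rewrite inE /= Zg => /(mulfI (lt0r_neq0 alpha0))/exp_inj.
have moment j k : (\sum_(r < 3) \sum_(s < 3)
      w r s * (Xf (r : nat, s : nat) ^+ j * Yf (r : nat, s : nat) ^+ k)) =
    alpha ^+ j * alpha ^+ k *
    (\sum_(r < 3) \sum_(s < 3) w r s * ((beta ^+ j) ^+ r * (beta ^+ k) ^+ s)).
  rewrite mulr_sumr; apply: eq_bigr => r _.
  rewrite mulr_sumr; apply: eq_bigr => s _.
  by rewrite /Xf /Yf /= !exprMn -!exprM ![(r * _)%N]mulnC ![(s * _)%N]mulnC; ring.
have unifZ (Z : {RV P >-> R}) (g : nat * nat -> nat) :
    (forall t, Z t = alpha * beta ^+ g t) ->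
    (forall i, (i < 3)%N ->
      \sum_(r < 3) \sum_(s < 3) w r s * (g (r : nat, s : nat) == i)%:R = 3^-1) ->
    unif3 Z alpha (alpha * beta) (alpha * beta ^+ 2).
  move=> Zg marg; split.
  - by have := atom _ _ 0%N Zg; rewrite expr0 mulr1 marg.
  - by have := atom _ _ 1%N Zg; rewrite expr1 marg.
  - by rewrite (atom _ _ 2%N Zg) marg.
exists _, _, P, X, Y; split.
- apply: (unifZ X fst) => // -[|[|[|//]]] _;
    by rewrite /w /h /D0 /D1 !big_ord_recr !big_ord0 /=; field.
- apply: (unifZ Y snd) => // -[|[|[|//]]] _;
    by rewrite /w /h /D0 /D1 !big_ord_recr !big_ord0 /=; field.
have EXY j k : ('E_P[fun t => (X t ^+ j * Y t ^+ k)%R] =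
    (alpha ^+ j * alpha ^+ k * (\sum_(r < 3) \sum_(s < 3)
      w r s * ((beta ^+ j) ^+ r * (beta ^+ k) ^+ s)))%R%:E)%E.
  rewrite EP ?moment//.
    by apply: measurable_funM; exact: measurable_funX.
  by move=> t; rewrite mulr_ge0 ?exprn_ge0// ?X0 ?Y0.
(* One-variable moments are mixed moments with a zero exponent. *)
have EX j : ('E_P[fun t => (X t ^+ j)%R] =
    'E_P[fun t => (X t ^+ j * Y t ^+ 0)%R])%E.
  by congr expectation; apply/funext => t; rewrite expr0 mulr1.
have EY k : ('E_P[fun t => (Y t ^+ k)%R] =
    'E_P[fun t => (X t ^+ 0 * Y t ^+ k)%R])%E.
  by congr expectation; apply/funext => t; rewrite expr0 mul1r.
apply/seteqP.
suff UE j k : (0 < j)%N -> (0 < k)%N ->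
    ('E_P[fun t => (X t ^+ j * Y t ^+ k)%R] =
     'E_P[fun t => (X t ^+ j)%R] * 'E_P[fun t => (Y t ^+ k)%R])%E <->
    a + b * beta ^+ j + c * beta ^+ k + d * (beta ^+ j * beta ^+ k) = 0.
  by split => -[j k] /= [[j0 k0] H]; split => //; apply/UE.
move=> j0 k0; rewrite EX EY !EXY -EFinM.
have xj : 1 < beta ^+ j by rewrite exprn_egt1 ?gtn_eqF.
have yk : 1 < beta ^+ k by rewrite exprn_egt1 ?gtn_eqF.
rewrite !expr0; move: (beta ^+ j) (beta ^+ k) xj yk => x y x1 y1.
have aj : alpha ^+ j * alpha ^+ k != 0 by rewrite mulf_neq0 ?expf_neq0 ?gt_eqF.
set G := a + _ + _ + _.
have key : alpha ^+ j * alpha ^+ k *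
   (\sum_(r < 3) \sum_(s < 3) w r s * (x ^+ r * y ^+ s)) -
   alpha ^+ j * 1 * (\sum_(r < 3) \sum_(s < 3) w r s * (x ^+ r * 1 ^+ s)) *
   (1 * alpha ^+ k * (\sum_(r < 3) \sum_(s < 3) w r s * (1 ^+ r * y ^+ s))) =
   alpha ^+ j * alpha ^+ k * (e * (x - 1) * (y - 1)) * G.
  by rewrite /G /w /h /D0 /D1 !big_ord_recr !big_ord0 /=; field.
split => [[/eqP]|G0].
  rewrite -subr_eq0 key mulf_eq0 mulf_eq0 (negbTE aj) !mulf_eq0 !subr_eq0.
  by rewrite (gt_eqF e0) (gt_eqF x1) (gt_eqF y1) /= => /eqP.
by congr EFin; apply/eqP; rewrite -subr_eq0 key G0 mulr0.
Qed.

(** * The threshold *)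

(** [x ^+ m.+1 / (x ^+ 2 + x + 1)] increases on [(1, +oo)]; this gives both
    the uniqueness of the root and the sign of the polynomial beyond it. *)
Lemma sum_small_powers_lt (R : realFieldType) (m : nat) (a b : R) :
  (2 <= m)%N -> 1 < a -> a < b ->
  a ^+ 2 + a + 1 <= a ^+ m.+1 -> b ^+ 2 + b + 1 < b ^+ m.+1.
Proof.
case: m => [|[|n]]// _ a1 ab aP.
have a0 : 0 < a by lra.
have b0 : 0 < b by lra.
have abn : a ^+ n <= b ^+ n by apply: lerXn2r; rewrite ?nnegrE; lra.
have a3 : 0 < a ^+ 3 by rewrite exprn_gt0.
have b3 : 0 < b ^+ 3 by rewrite exprn_gt0.
(* The case of exponent 3 carries the strict inequality; the remaining factors
   only use that [a ^+ n <= b ^+ n]. *)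
rewrite -(ltr_pM2l a3).
apply: (@lt_le_trans _ _ (b ^+ 3 * (a ^+ 2 + a + 1))).
  rewrite -subr_gt0.
  have -> : b ^+ 3 * (a ^+ 2 + a + 1) - a ^+ 3 * (b ^+ 2 + b + 1) =
    (b - a) * (a ^+ 2 * b ^+ 2 + a * b * (a + b) + (a ^+ 2 + a * b + b ^+ 2)).
    by ring.
  by rewrite mulr_gt0 ?subr_gt0// !addr_gt0 ?mulr_gt0 ?exprn_gt0 ?addr_gt0.
apply: (@le_trans _ _ (b ^+ 3 * a ^+ n.+3)); first by rewrite ler_pM2l.
rewrite -(addn3 n) !exprD mulrCA [leRHS]mulrCA [a ^+ 3 * _]mulrC.
by rewrite ler_pM2r ?mulr_gt0.
Qed.

Lemma threshold_exists (R : rcfType) (m : nat) : (2 <= m)%N ->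
  exists2 beta0 : R, 1 < beta0 & beta0 ^+ m.+1 - beta0 ^+ 2 - beta0 - 1 = 0.
Proof.
move=> m2.
pose p : {poly R} := 'X^(m.+1) - 'X^2 - 'X - 1.
have pE (x : R) : p.[x] = x ^+ m.+1 - x ^+ 2 - x - 1.
  by rewrite /p !hornerE.
have p1 : p.[1] < 0 by rewrite pE !expr1n; lra.
(* [2 ^+ m.+1 - 7] is positive because [3 <= m.+1]. *)
have p2 : 0 <= p.[2].
  rewrite pE.
  have : (2 : R) ^+ 3 <= 2 ^+ m.+1 by apply: ler_weXn2l; [lra|].
  lra.
have [||x /andP[x1 _] /eqP px] := @poly_ivt R p 1 2; first by lra.
  by rewrite (ltW p1) p2.
exists x; last by rewrite -pE.
rewrite lt_neqAle x1 andbT; apply/eqP => x1'.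
by move: p1; rewrite x1' px ltxx.
Qed.

(** * The bilinear form through the three points *)

(** The bilinear form vanishing at [(q, Q)], [(q ^+ 2, Q ^+ 2)] and
    [(q ^+ 3, Q ^+ 3)], written so as to show numerator and denominator of the
    Moebius map whose graph is its zero set; it is obtained by equating the cross
    ratios [(x, q; q ^+ 2, q ^+ 3)] and [(y, Q; Q ^+ 2, Q ^+ 3)]. *)
Definition moebius_form (R : comPzRingType) (q Q x y : R) : R :=
  y * (q ^+ 2 * (q * Q - 1) - (Q - q) * x)
  - Q ^+ 2 * ((q * Q - 1) * x - q ^+ 2 * (Q - q)).

Lemma moebius_uncorrelatedness (R : realType) (alpha beta Q : R) :
  0 < alpha -> 1 < beta ->
  exists (disp : measure_display) (T : measurableType disp)
         (P : probability T R) (X Y : {RV P >-> R}),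
    [/\ unif3 X alpha (alpha * beta) (alpha * beta ^+ 2),
        unif3 Y alpha (alpha * beta) (alpha * beta ^+ 2) &
        uncorrelatedness_set X Y =
        [set jk | posnat2 jk /\
          moebius_form beta Q (beta ^+ jk.1) (beta ^+ jk.2) = 0]].
Proof.
move=> alpha0 beta1.
have [d [T [P [X [Y [uX uY UE]]]]]] := bilinear_uncorrelatedness
  (Q ^+ 2 * beta ^+ 2 * (Q - beta)) (- (Q ^+ 2 * (beta * Q - 1)))
  (beta ^+ 2 * (beta * Q - 1)) (- (Q - beta)) alpha0 beta1.
exists d, T, P, X, Y; split=> //; rewrite UE.
apply/funext => jk; congr (_ /\ _ = 0).
by rewrite /moebius_form; ring.
Qed.

Lemma moebius_form_diag (R : comPzRingType) (q Q : R) (i : nat) :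
  (0 < i < 4)%N -> moebius_form q Q (q ^+ i) (Q ^+ i) = 0.
Proof.
by case: i => [|[|[|[|]]]]// _; rewrite /moebius_form; ring.
Qed.

(** The coefficient of [y] is positive for [x <= q ^+ 3], its value at
    [x = q ^+ 3] being [q ^+ 2 * (q ^+ 2 - 1)]; hence the form determines [y]. *)
Lemma moebius_form_before_pole (R : realFieldType) (q Q y : R) (i : nat) :
  1 < q -> q < Q -> (0 < i < 4)%N ->
  moebius_form q Q (q ^+ i) y = 0 -> y = Q ^+ i.
Proof.
move=> q1 qQ i4; have := moebius_form_diag q Q i4.
rewrite /moebius_form => /eqP; rewrite subr_eq0 => /eqP <- /eqP.
rewrite subr_eq0 => /eqP/mulIf; apply.
have qi : q ^+ i <= q ^+ 3 by apply: ler_weXn2l; [lra|lia].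
rewrite gt_eqF// subr_gt0.
apply: (@le_lt_trans _ _ ((Q - q) * q ^+ 3)); first by rewrite ler_pM2l ?subr_gt0.
rewrite -subr_gt0.
have -> : q ^+ 2 * (q * Q - 1) - (Q - q) * q ^+ 3 = q ^+ 2 * (q ^+ 2 - 1) by ring.
by rewrite mulr_gt0 ?exprn_gt0 ?subr_gt0 ?exprn_egt1//; lra.
Qed.

(** The condition [q ^+ 2 + q + 1 <= q * Q] makes the coefficient of [y]
    nonpositive at [x = q ^+ 4], hence at all larger [x], while the numerator of
    the Moebius map is positive there. *)
Lemma moebius_form_beyond_pole (R : realFieldType) (q Q y : R) (j : nat) :
  1 < q -> q < Q -> q ^+ 2 + q + 1 <= q * Q -> (3 < j)%N -> 0 < y ->
  moebius_form q Q (q ^+ j) y < 0.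
Proof.
move=> q1 qQ pole j4 y0.
have q0 : 0 < q by lra.
have xj : q ^+ 4 <= q ^+ j by apply: ler_weXn2l; [lra|].
rewrite /moebius_form subr_lt0.
apply: (@le_lt_trans _ _ 0).
  rewrite pmulr_rle0// subr_le0.
  apply: (@le_trans _ _ ((Q - q) * q ^+ 4)); last by rewrite ler_pM2l ?subr_gt0.
  rewrite -subr_ge0.
  have -> : (Q - q) * q ^+ 4 - q ^+ 2 * (q * Q - 1) =
     q ^+ 2 * (q - 1) * (q * Q - (q ^+ 2 + q + 1)) by ring.
  by rewrite !mulr_ge0 ?exprn_ge0//; lra.
have Q0 : 0 < Q by lra.
rewrite mulr_gt0 ?exprn_gt0// subr_gt0.
have qQ1 : 0 < q * Q - 1 by rewrite subr_gt0 mulr_egt1//; lra.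
apply: (@lt_le_trans _ _ ((q * Q - 1) * q ^+ 4)); last by rewrite ler_pM2l.
have q21 : 1 < q ^+ 2 by rewrite exprn_egt1.
rewrite -subr_gt0.
have -> : (q * Q - 1) * q ^+ 4 - q ^+ 2 * (Q - q) =
  q ^+ 2 * (Q * (q ^+ 3 - 1) - q * (q - 1)) by ring.
rewrite mulr_gt0 ?exprn_gt0// subr_gt0.
have q3 : q < q ^+ 3.
  by rewrite exprS -[ltLHS]mulr1 ltr_pM2l.
by apply: ltr_pM; lra.
Qed.

(** * A fourth point below the threshold *)

(** Up to the factor [q ^+ 2 * (1 - q)], the value at [(q ^+ 4, q ^+ k)] of the
    form with [Q = q ^+ m], as a polynomial in [q]. *)
Definition fourth_point_poly (R : nzRingType) (m k : nat) : {poly R} :=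
  'X^(3 * m) * ('X^2 + 'X + 1) - 'X^(2 * m + 1)
  - 'X^k * ('X^2 + 'X + 1 - 'X^(m.+1)).

Lemma horner_fourth_point_poly (R : comNzRingType) (m k : nat) (q : R) :
  (fourth_point_poly R m k).[q] =
  q ^+ (3 * m) * (q ^+ 2 + q + 1) - q ^+ (2 * m + 1)
  - q ^+ k * (q ^+ 2 + q + 1 - q ^+ m.+1).
Proof. by rewrite /fourth_point_poly !hornerE. Qed.

Lemma moebius_form_fourth_point (R : comNzRingType) (m k : nat) (q : R) :
  moebius_form q (q ^+ m) (q ^+ 4) (q ^+ k) =
  q ^+ 2 * (1 - q) * (fourth_point_poly R m k).[q].
Proof.
rewrite /moebius_form horner_fourth_point_poly addn1 [q ^+ m.+1]exprS
  [q ^+ (2 * m).+1]exprS.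
by rewrite [(3 * m)%N]mulnC [(2 * m)%N]mulnC !exprM; ring.
Qed.

(** The polynomial has a trivial root at 1, where its derivative
    [8 * m - 2 * k] is negative, and it is positive at the threshold [b]; the
    intermediate value theorem applies to its quotient by ['X - 1], whose value
    at 1 is that derivative. *)
Lemma fourth_point_root (R : rcfType) (m k : nat) (b : R) :
  (2 <= m)%N -> (4 * m < k)%N -> 1 < b -> b ^+ m.+1 = b ^+ 2 + b + 1 ->
  exists2 q : R, 1 < q < b & (fourth_point_poly R m k).[q] = 0.
Proof.
move=> m2 k4 b1 bE; set p := fourth_point_poly R m k.
have p1 : root p 1.
  by rewrite /root /p horner_fourth_point_poly !expr1n; apply/eqP; ring.
have [s ps] := factor_theorem _ _ p1.
have s1 : s.[1] < 0.
  have -> : s.[1] = p^`().[1].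
    by rewrite ps derivM derivXsubC !hornerE subrr mulr0 add0r.
  rewrite /p /fourth_point_poly !derivB !derivM !derivXn derivB !derivD !derivXn.
  rewrite derivX derivC !hornerE !hornerMn !hornerXn !expr1n -[m.+1]addn1 !natrD.
  have : ((4 * m)%:R : R) < k%:R by rewrite ltr_nat.
  rewrite !natrM; lra.
have sb : 0 < s.[b].
  have : 0 < p.[b].
    have -> : p.[b] = b ^+ (2 * m) * (b ^+ m * (b ^+ 2 + b + 1) - b) +
       b ^+ k * (b ^+ m.+1 - (b ^+ 2 + b + 1)).
      rewrite /p horner_fourth_point_poly addn1 [b ^+ m.+1]exprS
        [b ^+ (2 * m).+1]exprS.
      by rewrite [(3 * m)%N]mulnC [(2 * m)%N]mulnC !exprM; ring.
    rewrite bE subrr mulr0 addr0 mulr_gt0 ?exprn_gt0//; try lra.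
    have bm : 1 < b ^+ m by rewrite exprn_egt1// gtn_eqF//; lia.
    have b2 : 1 < b ^+ 2 by rewrite exprn_egt1.
    rewrite subr_gt0; apply: (@lt_trans _ _ (b ^+ 2 + b + 1)); first lra.
    by rewrite -[ltLHS]mul1r ltr_pM2r//; lra.
  rewrite ps !hornerE pmulr_lgt0//; lra.
have [||q /andP[q1 qb] /eqP sq] := @poly_ivt R s 1 b; first exact: ltW.
  by rewrite (ltW s1) (ltW sb).
exists q; last by rewrite ps hornerM sq mul0r.
rewrite !lt_neqAle q1 qb !andbT; apply/andP; split; apply/eqP => qE.
  by move: s1; rewrite qE sq ltxx.
by move: sb; rewrite -qE sq ltxx.
Qed.

(** * The theorem *)

Theorem theorem3p6 (R : realType) (m : nat) (hm : (2 <= m)%N)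
    (alpha : R) (halpha : 0 < alpha) :
  let A : set (nat * nat) :=
    [set (1%N, m)] `|` [set (2%N, (2 * m)%N)] `|` [set (3%N, (3 * m)%N)] in
  exists beta0 : R,
    [/\ unique (fun beta : R =>
          1 < beta /\ beta ^+ m.+1 - beta ^+ 2 - beta - 1 = 0) beta0,
        forall beta : R, beta0 <= beta ->
          exists (d : measure_display) (T : measurableType d)
                 (P : probability T R) (X Y : {RV P >-> R}),
            [/\ unif3 X alpha (alpha * beta) (alpha * beta ^+ 2),
                unif3 Y alpha (alpha * beta) (alpha * beta ^+ 2) &
                uncorrelatedness_set X Y = A]
      & forall k : nat, (4 * m < k)%N ->
          exists beta : R, 1 < beta < beta0 /\
          exists (d : measure_display) (T : measurableType d)
                 (P : probability T R) (X Y : {RV P >-> R}),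
            [/\ unif3 X alpha (alpha * beta) (alpha * beta ^+ 2),
                unif3 Y alpha (alpha * beta) (alpha * beta ^+ 2),
                [set (4%N, k)] `|` A `<=` uncorrelatedness_set X Y &
                uncorrelatedness_set X Y <> posnat2]].
Proof.
move=> A.
have [b0 b01 b0E] := threshold_exists R hm.
have b0P : b0 ^+ m.+1 = b0 ^+ 2 + b0 + 1 by lra.
have expE (q : R) i : q ^+ (i * m) = (q ^+ m) ^+ i by rewrite mulnC exprM.
have A_sub (q : R) jk : A jk -> posnat2 jk /\
    moebius_form q (q ^+ m) (q ^+ jk.1) (q ^+ jk.2) = 0.
  move=> Ajk; suff [i i13 ->] : exists2 i, (0 < i < 4)%N & jk = (i, (i * m)%N).
    split; first by split; rewrite /= ?muln_gt0; lia.
    by rewrite /= expE; exact: moebius_form_diag.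
  by case: Ajk => [[->|->]|->];
    [exists 1%N; rewrite ?mul1n|exists 2%N|exists 3%N].
exists b0; split.
- split=> // b [b1 bE]; have bP : b ^+ m.+1 = b ^+ 2 + b + 1 by lra.
  case: (ltgtP b0 b) => // [lt|lt].
    by have := sum_small_powers_lt hm b01 lt; rewrite b0P bP lexx ltxx => /(_ isT).
  by have := sum_small_powers_lt hm b1 lt; rewrite b0P bP lexx ltxx => /(_ isT).
- move=> b b0b; have b1 : 1 < b by lra.
  have pole : b ^+ 2 + b + 1 <= b * b ^+ m.
    rewrite -exprS; move: b0b; rewrite le_eqVlt => /predU1P[<-|lt].
      by rewrite b0P.
    by apply/ltW/(sum_small_powers_lt hm b01); rewrite ?b0P.
  have bQ : b < b ^+ m by rewrite -[ltLHS]expr1 ltr_eXn2l.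
  have [d [T [P [X [Y [uX uY UE]]]]]] := moebius_uncorrelatedness (b ^+ m) halpha b1.
  exists d, T, P, X, Y; split=> //; rewrite UE.
  apply/seteqP; split => [[j k] /= [[/= j0 k0] G0]|jk /(A_sub b)//].
  have [j4|j4] := ltnP j 4; last first.
    have k_gt0 : 0 < b ^+ k by rewrite exprn_gt0; lra.
    by have := moebius_form_beyond_pole b1 bQ pole j4 k_gt0; rewrite G0 ltxx.
  have := moebius_form_before_pole b1 bQ _ G0; rewrite j0 j4 => /(_ isT).
  rewrite -expE => /(ieexprIn _ _) ->; [|lra|by rewrite gt_eqF].
  by move: j j4 j0 {G0} => [|[|[|[|//]]]]// _ _; rewrite /A /= ?mul1n; tauto.
- move=> k k4; have [q /andP[q1 qb0] qk] := fourth_point_root hm k4 b01 b0P.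
  exists q; split; first by rewrite q1.
  have qQ : q < q ^+ m by rewrite -[ltLHS]expr1 ltr_eXn2l.
  have [d [T [P [X [Y [uX uY UE]]]]]] := moebius_uncorrelatedness (q ^+ m) halpha q1.
  exists d, T, P, X, Y; split=> //; rewrite UE.
    move=> jk [->|/(A_sub q)//]; split; first by split=> //=; lia.
    have := moebius_form_fourth_point m k q; rewrite qk mulr0; exact.
  (* At [x = q] only [y = q ^+ m] is a zero, so [(1, 2 * m)] is correlated. *)
  move=> Upos; have : posnat2 (1%N, (2 * m)%N) by split=> //=; lia.
  rewrite -Upos /= => -[_ G0].
  have := moebius_form_before_pole q1 qQ _ G0 => /(_ isT).
  rewrite expr1 => /(ieexprIn _ _) E.
  have : (2 * m)%N = m by apply: E; [lra|rewrite gt_eqF].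
  by lia.
Qed.
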